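(* Let $d\ge3$, let $\tau\in S_d$, let $r_1=1$, and let $R\in\mathbb N_+$ satisfy $\min\{n_{\tau(1)},n_{\tau(d)}\}\ge R$ and $\min_{2\le j\le d-1} n_{\tau(j)}\ge R^2>\max_{2\le j\le d} r_j\ge\min_{2\le j\le d} r_j\ge R$. Then there is a Lebesgue-measure-zero set $\mathcal N\subset\mathcal U^d_{\vec r,\vec n,\tau}$ such that for every $\vec{\mathbf u}\in\mathcal U^d_{\vec r,\vec n,\tau}\setminus\mathcal N$, the Train Recovery Algorithm, run with the integer $R$ and with exact access to the entries of $\mathbf T=\varphi(\vec{\mathbf u},\tau)$, returns an element of $\mathcal CS^d_{\mathrm{TT}}(\tau)$.
   Context: **Tensor train format.** $d$ is a positive integer, $S_d$ is the group of permutations of $\{1,\dots,d\}$, and $\vec n=(n_1,\dots,n_d)$, $\vec r=(r_1,\dots,r_d)$ are vectors of positive integers with $r_1=1$; subscripts of $r$ are read modulo $d$ (so $r_{d+1}=r_1=1$). For $\tau\in S_d$ let $\mathcal U^d_{\vec r,\vec n,\tau}=\bigoplus_{i=1}^d\mathbb R^{r_{\tau^{-1}(i)}\times n_i\times r_{\tau^{-1}(i)+1}}$, a Euclidean space with Lebesgue measure. For $\vec{\mathbf u}=(\mathbf u^{[1]},\dots,\mathbf u^{[d]})$ in it, write $\mathbf u^{[i]}(x)=\mathbf u^{[i]}(:,x,:)\in\mathbb R^{r_{\tau^{-1}(i)}\times r_{\tau^{-1}(i)+1}}$. The tensor $\varphi(\vec{\mathbf u},\tau)\in\mathbb R^{n_1\times\cdots\times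 n_d}$ has entries (the $1\times1$ matrix product) $$\varphi(\vec{\mathbf u},\tau)(x_1,\dots,x_d)=\mathbf u^{[\tau(1)]}(x_{\tau(1)})\,\mathbf u^{[\tau(2)]}(x_{\tau(2)})\cdots\mathbf u^{[\tau(d)]}(x_{\tau(d)}).$$ **Equivalence class.** $\mathcal CS^d_{\mathrm{TT}}(\tau)=\{\tau,\tau\circ\beta\}$, where $\beta(j)=d+1-j$. **Matricizations.** Given distinct $i_1,i_2,i_3$ and fixed $y_i\in\{1,\dots,n_i\}$ for $i\notin\{i_1,i_2,i_3\}$, let $A(x_{i_1},x_{i_2},x_{i_3})$ be the entry of the tensor whose $i_s$-th coordinate is $x_{i_s}$ ($1\le s\le3$) and whose $i$-th coordinate is $y_i$ for all other $i$. Define $M_{i_1,(i_2,i_3)}\in\mathbb R^{n_{i_1}\times(n_{i_2}n_{i_3})}$, $M_{i_2,(i_3,i_1)}\in\mathbb R^{n_{i_2}\times(n_{i_3}n_{i_1})}$, $M_{i_3,(i_1,i_2)}\in\mathbb R^{n_{i_3}\times(n_{i_1}n_{i_2})}$ by $M_{i_1,(i_2,i_3)}(x_{i_1},(x_{i_2},x_{i_3}))=M_{i_2,(i_3,i_1)}(x_{i_2},(x_{i_3},x_{i_1}))=M_{i_3,(i_1,i_2)}(x_{i_3},(x_{i_1},x_{i_2}))=A(x_{i_1},x_{i_2},x_{i_3})$. $\sigma_k(M)$ denotes the $k$-th largest singular value of $M$, with $\sigma_k(M)=0$ if $k$ exceeds the smaller dimension of $M$. **Three-Index Algorithm.** Input: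 $i_1,i_2,i_3$, an integer $R\in\mathbb N_+$, and an oracle for the entries of $\mathbf T$. Sample (i.e. pick arbitrarily) $y_i\in\{1,\dots,n_i\}$ for $i\notin\{i_1,i_2,i_3\}$; form the three matrices above from $\mathbf T$. Compare $a=\sigma_{R^2}(M_{i_1,(i_2,i_3)})$, $b=\sigma_{R^2}(M_{i_2,(i_3,i_1)})$, $c=\sigma_{R^2}(M_{i_3,(i_1,i_2)})$. If $a>\max\{b,c\}$ return $(i_2,i_1,i_3)$; if $b>\max\{a,c\}$ return $(i_1,i_2,i_3)$; if $c>\max\{a,b\}$ return $(i_2,i_3,i_1)$. **Train Recovery Algorithm.** Input: $R\in\mathbb N_+$ and an oracle for the entries of $\mathbf T$. 1. Let $(i_1,i_2,i_3)$ be the output of the Three-Index Algorithm on $1,2,3$. 2. For $t=3,\dots,d-1$: set $j_{\min}=0$, $j_{\max}=t+1$. While $j_{\max}-j_{\min}\ge2$: (i) if $j_{\max}-j_{\min}\ge3$, set $j_1=j_{\min}+\lfloor\frac13(j_{\max}-j_{\min})\rfloor$, $j_2=j_{\min}+\lfloor\frac23(j_{\max}-j_{\min})\rfloor$; else if $j_{\min}\ge1$, set $j_1=j_{\min}$, $j_2=j_{\min}+1$; else set $j_1=1$, $j_2=2$; (ii) run the Three-Index Algorithm on $t+1,i_{j_1},i_{j_2}$; if its output is $(t+1,i_{j_1},i_{j_2})$ or $(i_{j_2},i_{j_1},t+1)$, set $j_{\max}=j_1$; else if it is $(i_{j_1},t+1,i_{j_2})$ or $(i_{j_2},t+1,i_{j_1})$,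 set $j_{\min}=j_1$, $j_{\max}=j_2$; else set $j_{\min}=j_2$. After the while loop, replace $(i_1,\dots,i_t)$ by $(i_1,\dots,i_{j_{\min}},t+1,i_{j_{\max}},\dots,i_t)$ (the part before $t+1$ is empty if $j_{\min}=0$, the part after is empty if $j_{\max}=t+1$). 3. Return $\tau'\in S_d$ with $\tau'(j)=i_j$ for $1\le j\le d$. *)

(* Defs.v *)
From HB Require Import structures.
From mathcomp Require Import all_boot all_order all_fingroup all_algebra.
From mathcomp Require Import polyrcf.
From mathcomp Require Import all_classical all_reals all_analysis.
Set Implicit Arguments. Unset Strict Implicit. Unset Printing Implicit Defensive.
Import Order.TTheory GRing.Theory Num.Theory.
Local Open Scope classical_set_scope.
Local Open Scope ring_scope.

(* Lebesgue measure on R^n, n-fold product of the library's one-dimensional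
   Lebesgue measure; [lebesgue_tuple_box] is the property characterizing it. *)
Section lebesgue_tuple.
Local Open Scope ereal_scope.
Variable R : realType.
Notation RR := (measurableTypeR R).

Definition cons_pair (n : nat) (z : RR * n.-tuple RR) : n.+1.-tuple RR :=
  [tuple of z.1 :: z.2].

Section succ.
Variables (n : nat) (mu : {sigma_finite_measure set (n.-tuple RR) -> \bar R}).

Lemma measurable_cons_pair : measurable_fun [set: RR * n.-tuple RR] (@cons_pair n).
Proof. exact: measurable_cons. Qed.

Definition lebesgue_cons : set (n.+1.-tuple RR) -> \bar R :=
  pushforward (@lebesgue_measure R \x mu) (@cons_pair n).

Let lc0 : lebesgue_cons set0 = 0.
Proof. by rewrite /lebesgue_cons /pushforward preimage_set0 measure0. Qed.
Let lc_ge0 A : 0 <= lebesgue_cons A.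
Proof. by rewrite /lebesgue_cons /pushforward. Qed.
Let lc_sa : semi_sigma_additive lebesgue_cons.
Proof.
have mf := measurable_cons_pair.
move=> F mF tF mUF; rewrite /lebesgue_cons /pushforward preimage_bigcup.
apply: measure_semi_sigma_additive.
- by move=> k; rewrite -[X in measurable X]setTI; exact: mf.
- apply/trivIsetP => /= i j _ _ ij; rewrite -preimage_setI.
  by move/trivIsetP : tF => /(_ _ _ _ _ ij) ->//; rewrite preimage_set0.
- by rewrite -preimage_bigcup -[X in measurable X]setTI; exact: mf.
Qed.

HB.instance Definition _ := isMeasure.Build _ _ _ lebesgue_cons lc0 lc_ge0 lc_sa.

(* The sigma-finite instance of [\x] is not inferred here (it is shadowed in the
   library by the one for subprobabilities), hence the direct proof. *)
Let lc_sf : sigma_finite setT lebesgue_cons.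
Proof.
have /sigma_finiteP[F [TF ndF Foo]] := sigma_finiteT (@lebesgue_measure R).
have /sigma_finiteP[G [TG ndG Goo]] := sigma_finiteT mu.
pose g (t : n.+1.-tuple RR) : (RR * n.-tuple RR)%type :=
  (thead t, [tuple of behead t]).
have mg : measurable_fun setT g.
  by apply/measurable_fun_pairP; split;
    [exact: measurable_tnth|exact: measurable_behead].
exists (fun k => g @^-1` (F k `*` G k)) => [|k].
  rewrite -preimage_bigcup (_ : \bigcup_k _ = setT) ?preimage_setT//.
  rewrite -setXTT TF TG predeqE => -[x y]; split.
    by move=> [k _ []/= ? ?]; split; exists k.
  move=> [/= [k _ Fkx] [l _ Gly]]; exists (maxn k l) => //; split.
  - by move: x Fkx; exact/subsetPset/ndF/leq_maxl.
  - by move: y Gly; exact/subsetPset/ndG/leq_maxr.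
have [mF Fk] := Foo k; have [mG Gk] := Goo k; split.
  by rewrite -[X in measurable X]setTI; apply: mg => //; exact: measurableX.
rewrite /lebesgue_cons /pushforward -comp_preimage.
rewrite (_ : g \o _ = id); last first.
  by apply/funext => -[x t]; congr pair; apply/val_inj.
by rewrite preimage_id product_measure1E// lte_mul_pinfty// ge0_fin_numE.
Qed.

HB.instance Definition _ := Measure_isSigmaFinite.Build _ _ _ lebesgue_cons lc_sf.
End succ.

Fixpoint lebesgue_tuple (n : nat) :
    {sigma_finite_measure set (n.-tuple RR) -> \bar R} :=
  match n with
  | 0 => \d_([tuple] : 0.-tuple RR)
  | m.+1 => lebesgue_cons (lebesgue_tuple m)
  end.

Lemma measurable_box n (A : 'I_n -> set RR) : (forall i, measurable (A i)) ->
  measurable [set t : n.-tuple RR | forall i, A i (tnth t i)].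
Proof.
move=> mA.
rewrite (_ : [set _ | _] =
  \big[setI/setT]_(i < n) ((fun t : n.-tuple RR => tnth t i) @^-1` A i)).
  apply: bigsetI_measurable => i _; rewrite -[X in measurable X]setTI.
  by apply: (measurable_tnth i) => //; exact: mA.
rewrite -bigcap_seq; apply/seteqP; split => [t At i /= _|t At i]; first exact: At.
by apply: At; rewrite /= mem_index_enum.
Qed.

Lemma lebesgue_tuple_box n (A : 'I_n -> set RR) : (forall i, measurable (A i)) ->
  lebesgue_tuple n [set t | forall i, A i (tnth t i)] =
  \prod_(i < n) lebesgue_measure (A i).
Proof.
elim: n A => [|n IHn] A mA.
  by rewrite big_ord0 /= diracE mem_set //= => -[].
rewrite big_ord_recl -IHn; last by move=> i.
pose B := [set t : n.-tuple RR | forall i, A (lift ord0 i) (tnth t i)].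
have mB : measurable B by apply: (@measurable_box _ (fun i => A (lift ord0 i))) => i; exact: mA.
have <- := @product_measure1E _ _ _ _ _ (@lebesgue_measure R)
  (lebesgue_tuple n) _ _ (mA ord0) mB.
rewrite /= /lebesgue_cons /pushforward; congr (_ _).
apply/seteqP; split => [[x t] /= At|[x t] /= [Ax At] i].
  split => [|i]; first exact: (At ord0).
  by have := At (lift ord0 i); rewrite /cons_pair /= tnthS.
have [->//|i0] := eqVneq i ord0.
have [j ->] : exists j, i = lift ord0 j.
  by case: (unliftP ord0 i) i0 => [j ->|->]; [exists j|rewrite eqxx].
by rewrite /cons_pair /= tnthS; exact: At.
Qed.
End lebesgue_tuple.

Section singular_values.
Variable R : realType.

(* Roots of the characteristic polynomial, with multiplicity, in decreasing
   order; for symmetric A these are all the eigenvalues. *)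
Definition real_eigenvalues (m : nat) (A : 'M[R]_m) : seq R :=
  flatten [seq nseq (mup x (char_poly A)) x | x <- rev (rootsR (char_poly A))].

(* k is counted from 1. *)
Definition singular_value (k m n : nat) (M : 'M[R]_(m, n)) : R :=
  if (k <= minn m n)%N then
    Num.sqrt (nth 0 (real_eigenvalues (M *m M^T)) k.-1)
  else 0.

End singular_values.

(* Sites and positions are 0-based: the i-th site of the mathematical text is the
   element i - 1 of 'I_d.  [bond r j] is r_{j+1}, subscripts being mod d. *)
Definition bond (d : nat) (r : d.-tuple nat) (j : nat) : nat := nth 0%N r (j %% d).

Definition multi_index (d : nat) (n : d.-tuple nat) : Type :=
  forall i : 'I_d, 'I_(tnth n i).

Section tensor_train.
Variables (R : realType) (d : nat) (n r : d.-tuple nat) (tau : 'S_d).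

Definition tt_params : Type := forall i : 'I_d, 'I_(tnth n i) ->
  'M[R]_(bond r (tau^-1%g i), bond r (tau^-1%g i).+1).

Definition tt_coord_index : finType :=
  {i : 'I_d & ('I_(tnth n i) * 'I_(bond r (tau^-1%g i))
               * 'I_(bond r (tau^-1%g i).+1))%type}.

Definition tt_coords (u : tt_params) :
    #|{: tt_coord_index}|.-tuple (measurableTypeR R) :=
  [tuple let c := enum_val k in
         u (tag c) (tagged c).1.1 (tagged c).1.2 (tagged c).2
  | k < #|{: tt_coord_index}|].

Definition tt_null (N : set tt_params) : Prop :=
  (lebesgue_tuple R #|{: tt_coord_index}|).-negligible (tt_coords @` N).

Fixpoint mx_chain (s : nat -> nat) (A : forall j, 'M[R]_(s j, s j.+1)) (m : nat) :
    'M[R]_(s 0%N, s m) :=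
  if m is m'.+1 then mx_chain A m' *m A m' else 1%:M.

(* The factor at position j.  [conform_mx] only casts along
   tau^-1 (tau j) = j; its default is never used when j < d. *)
Definition tt_factor (u : tt_params) (x : multi_index n) (j : nat) :
    'M[R]_(bond r j, bond r j.+1) :=
  if insub j is Some p then conform_mx 0 (u (tau p) (x (tau p))) else 0.

(* The product has size bond r 0 x bond r d, which is 1 x 1 when r_1 = 1. *)
Definition tt_tensor (u : tt_params) (x : multi_index n) : R :=
  (conform_mx (0 : 'M[R]_1) (mx_chain (tt_factor u x) d)) 0 0.

Definition tt_class : {set 'S_d} :=
  [set s in [:: tau; (perm (@rev_ord_inj d) * tau)%g]]%SET.

End tensor_train.

Section algorithms.
Variables (R : realType) (d : nat) (n : d.-tuple nat) (rho : nat).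
Variable T : multi_index n -> R.

Definition matricization (y : multi_index n) (i j k : 'I_d) :
    'M[R]_(tnth n i, tnth n j * tnth n k) :=
  \matrix_(a < tnth n i) mxvec (\matrix_(b < tnth n j, c < tnth n k)
    T (dfwith (dfwith (dfwith y i a) j b) k c)).

(* y is the sample; its values at i1, i2, i3 are ignored.  None: no output,
   because none of the three strict comparisons holds. *)
Definition three_index (y : multi_index n) (i1 i2 i3 : 'I_d) :
    option ('I_d * 'I_d * 'I_d) :=
  let a := singular_value (rho ^ 2) (matricization y i1 i2 i3) in
  let b := singular_value (rho ^ 2) (matricization y i2 i3 i1) in
  let c := singular_value (rho ^ 2) (matricization y i3 i1 i2) in
  if Num.max b c < a then Some (i2, i1, i3)
  else if Num.max a c < b then Some (i1, i2, i3)
  else if Num.max a b < c then Some (i2, i3, i1)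
  else None.

Definition probes (jmin jmax : nat) : nat * nat :=
  if (3 <= jmax - jmin)%N then
    ((jmin + (jmax - jmin) %/ 3)%N, (jmin + (2 * (jmax - jmin)) %/ 3)%N)
  else if (1 <= jmin)%N then (jmin, jmin.+1)
  else (1%N, 2%N).

(* The while loop inserting x into s = (i_1, ..., i_t); ys k is the sample used
   by the k-th Three-Index call.  Exhausting the fuel counts as failure. *)
Fixpoint search_position (fuel : nat) (s : seq 'I_d) (x : 'I_d)
    (ys : nat -> multi_index n) (k jmin jmax : nat) : option (nat * nat) :=
  if (jmax - jmin < 2)%N then Some (jmin, jmax)
  else if fuel is fuel'.+1 then
    let: (j1, j2) := probes jmin jmax in
    let a := nth x s j1.-1 in
    let b := nth x s j2.-1 in
    if three_index (ys k) x a b is Some out then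
      let: (jmin', jmax') :=
        if out \in [:: (x, a, b); (b, a, x)] then (jmin, j1)
        else if out \in [:: (a, x, b); (b, x, a)] then (j1, j2)
        else (j2, jmax) in
      search_position fuel' s x ys k.+1 jmin' jmax'
    else None
  else None.

Definition insert_site (ys : nat -> multi_index n) (s : seq 'I_d) (x : 'I_d) :
    option (seq 'I_d) :=
  if search_position (size s).+1 s x ys 0 0 (size s).+1 is Some (jmin, jmax)
  then Some (take jmin s ++ x :: drop jmax.-1 s)
  else None.

(* Every Three-Index call has its own arbitrary sample: ys 0 0 in step 1, and
   ys t k in the k-th pass (k >= 0) of the while loop inserting site t + 1. *)
Definition train_recovery (ys : nat -> nat -> multi_index n) : option 'S_d :=
  if enum 'I_d is i1 :: i2 :: i3 :: rest then
    if three_index (ys 0%N 0%N) i1 i2 i3 is Some (a, b, c) then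
      let step (os : option (seq 'I_d)) (x : 'I_d) :=
        obind (fun s => insert_site (ys x) s x) os in
      obind (fun s => [pick t : 'S_d | codom t == s])
        (foldl step (Some [:: a; b; c]) rest)
    else None
  else None.

End algorithms.

(* Main.v *)
Require Import Defs.
From mathcomp Require Import all_boot all_order all_fingroup all_algebra.
From mathcomp Require Import all_classical all_reals all_analysis.
From mathcomp Require Import measurable_realfun polyrcf complex spectral sesquilinear zify.
Set Implicit Arguments. Unset Strict Implicit. Unset Printing Implicit Defensive.
Import Order.TTheory GRing.Theory Num.Theory.
Local Open Scope classical_set_scope.
Local Open Scope ring_scope.

(** The algorithm recovers a linear order, up to reversal, from betweenness queries;
    the point is that the singular value test answers these queries correctly for
    almost all parameters.

    Take three sites and fix all other indices.  A site that is not the middle one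
    of the three can be separated from the other two by cutting the train at an inner
    bond, so its matricization factors through a space of dimension less than
    [rho ^ 2], whatever the parameters ([rank_end_site]).  For the middle site the
    two neighbours carry at least [rho] indices each through bonds of size at least
    [rho], and a suitable choice of 0/1 factors makes a minor of size [rho ^ 2]
    of its matricization equal to the identity ([minor_witness]).  The determinant of
    this minor is therefore a polynomial function of the parameters that is not
    identically zero, and its zero set is null ([polyfun_zeros_null]).  There are
    finitely many triples of sites and finitely many samples, so one null set
    [degenerate] excludes all failures, and outside it the rank of a matricization
    reaches [rho ^ 2] exactly at the middle site ([generic_rank]).

    Singular values see the rank: the Gram matrix of a real matrix is diagonalizable
    with nonnegative eigenvalues, and as many of them are nonzero as the rank says
    ([char_poly_gram]), so the singular value of index [rho ^ 2] is positive exactly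
    when the rank is at least [rho ^ 2] ([singular_value_gt0]).  Hence the
    three-index test returns the three sites with the middle one in the middle
    ([middle_oracle_rank]).

    Given such an oracle, the list built by the algorithm is always sorted by position
    under [tau] or under its reversal; the search loop encloses the right gap for
    the next site until only that gap is left ([search_positionP]). *)

(** * Zero sets of polynomial functions *)

Section polyfun.
Variable R : realType.
Notation RR := (measurableTypeR R).

(** Polynomial functions as a generated class of functions: restricting one
    coordinate, measurability and closure under determinants are then all short
    inductions. *)
Inductive polyfun n : (n.-tuple RR -> R) -> Prop :=
| polyfun_cst c : polyfun (fun=> c)
| polyfun_coord i : polyfun (fun t => tnth t i)
| polyfun_add f g : polyfun f -> polyfun g -> polyfun (fun t => f t + g t)
| polyfun_mul f g : polyfun f -> polyfun g -> polyfun (fun t => f t * g t).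

Lemma polyfun_sum n (I : Type) (s : seq I) (P : pred I) (F : I -> n.-tuple RR -> R) :
  (forall i, polyfun (F i)) -> polyfun (fun t => \sum_(i <- s | P i) F i t).
Proof.
move=> pF; elim: s => [|i s IH].
  under eq_fun do rewrite big_nil; exact: polyfun_cst.
under eq_fun do rewrite big_cons; case: (P i) => //; exact: polyfun_add.
Qed.

Lemma polyfun_prod n (I : Type) (s : seq I) (P : pred I) (F : I -> n.-tuple RR -> R) :
  (forall i, polyfun (F i)) -> polyfun (fun t => \prod_(i <- s | P i) F i t).
Proof.
move=> pF; elim: s => [|i s IH].
  under eq_fun do rewrite big_nil; exact: polyfun_cst.
under eq_fun do rewrite big_cons; case: (P i) => //; exact: polyfun_mul.
Qed.

Lemma polyfun_det n k (M : n.-tuple RR -> 'M[R]_k) :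
  (forall i j, polyfun (fun t => M t i j)) -> polyfun (fun t => \det (M t)).
Proof.
move=> pM; apply: polyfun_sum => s; apply: polyfun_mul; first exact: polyfun_cst.
exact: polyfun_prod.
Qed.

Lemma measurable_polyfun n (f : n.-tuple RR -> R) :
  polyfun f -> measurable_fun setT (f : n.-tuple RR -> RR).
Proof.
elim=> [c|i|g h _ mg _ mh|g h _ mg _ mh].
- exact: measurable_cst.
- exact: measurable_tnth.
- exact: measurable_funD.
- exact: measurable_funM.
Qed.

Lemma polyfun_cons n (f : n.+1.-tuple RR -> R) (x : R) :
  polyfun f -> polyfun (fun t : n.-tuple RR => f (cons_pair (x, t))).
Proof.
elim=> [c|i|g h _ mg _ mh|g h _ mg _ mh].
- exact: polyfun_cst.
- case: (unliftP ord0 i) => [j ->|->].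
    rewrite (_ : (fun _ => _) = fun t => tnth t j); first exact: polyfun_coord.
    by apply/funext => t; rewrite tnthS.
  exact: polyfun_cst.
- exact: polyfun_add.
- exact: polyfun_mul.
Qed.

Lemma polyfun_head n (f : n.+1.-tuple RR -> R) (t : n.-tuple RR) :
  polyfun f -> exists p : {poly R}, forall x, f (cons_pair (x, t)) = p.[x].
Proof.
elim=> [c|i|g h _ [p pE] _ [q qE]|g h _ [p pE] _ [q qE]].
- by exists c%:P => x; rewrite hornerC.
- case: (unliftP ord0 i) => [j ->|->].
    by exists (tnth t j)%:P => x; rewrite hornerC tnthS.
  by exists 'X => x; rewrite hornerX.
- by exists (p + q) => x; rewrite hornerD pE qE.
- by exists (p * q) => x; rewrite hornerM pE qE.
Qed.

(** Induction on the number of variables, slicing along the first one.  For fixed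
    tail of [t0], [f] is a nonzero polynomial in its first coordinate, so outside
    its finitely many roots [x] the slice [f (x, _)] is again a polynomial
    function that is not identically zero, and its zero set is null. *)
Lemma polyfun_zeros_null n (f : n.-tuple RR -> R) (t0 : n.-tuple RR) :
  polyfun f -> f t0 != 0 -> lebesgue_tuple R n [set t | f t = 0] = 0%E.
Proof.
elim: n f t0 => [|n IH] f t0 pf ft0.
  rewrite /= diracE memNset //= => f0; move: ft0; rewrite (tuple0 t0).
  by rewrite f0 eqxx.
rewrite /= /lebesgue_cons /pushforward.
pose x0 := thead t0; pose s0 := [tuple of behead t0].
have t0E : t0 = cons_pair (x0, s0).
  by rewrite {1}(tuple_eta t0); exact: val_inj.
have [p pE] := polyfun_head s0 pf.
have pN0 : p != 0.
  by apply: contraNneq ft0 => p0; rewrite t0E pE p0 horner0.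
rewrite /product_measure1.
have mZ : measurable ((@cons_pair R n) @^-1` [set t | f t = 0]).
  rewrite -[X in measurable X]setTI; apply: measurable_cons_pair => //.
  rewrite -[X in measurable X]setTI.
  exact: (measurable_polyfun pf measurableT (measurable_set1 (0 : R))).
pose N : set R := [set` rootsR p].
have finN : finite_set N by exact: finite_seq.
have mN : measurable (N : set RR).
  exact: countable_measurable (finite_set_countable finN).
have N0 : lebesgue_measure (N : set RR) = 0%E.
  exact: countable_lebesgue_measure0 (finite_set_countable finN).
(* The product measure integrates the measures of the slices over the first
   coordinate, and the null set [N] of bad [x] may be left out. *)
rewrite (ge0_negligible_integral mN) //=; last exact: measurable_fun_xsection.
apply: integral0_eq => x [_ Nx] /=.
rewrite -[RHS](IH (fun t => f (cons_pair (x, t))) s0); last 2 first.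
- exact: polyfun_cons.
- rewrite pE; apply: contra_notN Nx => px0; rewrite /N /=.
  by rewrite -roots_on_rootsR // in_itv /=.
by congr (lebesgue_tuple R n _); apply/seteqP; split => t; rewrite /xsection /= inE.
Qed.
End polyfun.

(** * Singular values and rank *)

Lemma mulmx_tr_eq0 (R : realFieldType) n (v : 'rV[R]_n) : v *m v^T = 0 -> v = 0.
Proof.
move=> /matrixP /(_ ord0 ord0); rewrite !mxE => /eqP.
rewrite psumr_eq0 => [/allP h|i _]; last by rewrite mxE -expr2 sqr_ge0.
apply/rowP => i; rewrite mxE; have := h i (mem_index_enum i).
by rewrite mxE -expr2 sqrf_eq0 => /eqP.
Qed.

(** Over a real field the two kernels agree: [v M M^T = 0] forces
    [(v M) (v M)^T = 0], a vanishing sum of squares. *)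
Lemma mxrank_gram (R : realFieldType) m n (M : 'M[R]_(m, n)) : \rank (M *m M^T) = \rank M.
Proof.
apply/eqP; rewrite eqn_leq mxrankM_maxl /=.
suff h : (kermx (M *m M^T) <= kermx M)%MS.
  have := mxrankS h; rewrite !mxrank_ker.
  have := rank_leq_row M; have := rank_leq_row (M *m M^T).
  by move=> h1 h2 h3; rewrite -(leq_sub2lE (m := m)).
apply/row_subP => i; apply/sub_kermxP.
apply: mulmx_tr_eq0; rewrite trmx_mul mulmxA -(mulmxA _ M) -row_mul.
by rewrite mulmx_ker row0 mul0mx.
Qed.


Lemma mxrank_diag (F : fieldType) n (d : 'rV[F]_n) :
  \rank (diag_mx d) = (\sum_i (d 0 i != 0)%R)%N.
Proof.
elim: n d => [|n IH] d; first by rewrite flatmx0 mxrank0 big_ord0.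
pose dl : 'rV[F]_1 := @lsubmx _ 1 1 n d; pose dr : 'rV[F]_n := @rsubmx _ 1 1 n d.
have -> : \rank (diag_mx d) = (\rank (diag_mx dl) + \rank (diag_mx dr))%N.
  rewrite -rank_diag_block_mx -diag_mx_row (_ : row_mx dl dr = d) //.
  exact: (@hsubmxK _ 1 1 n).
rewrite IH big_ord_recl; congr (_ + _)%N.
  rewrite rank_rV; congr (nat_of_bool (~~ _)).
  have dl0 : dl 0 0 = d 0 ord0 by rewrite mxE; congr (d _ _); exact: val_inj.
  rewrite -dl0; move: {dl0}dl => dl; apply/eqP/eqP => [/matrixP /(_ 0 0)|dl00].
    by rewrite !mxE.
  by apply/matrixP => i j; rewrite !ord1 mxE dl00 mul0rn mxE.
by apply: eq_bigr => i _; rewrite mxE; congr (nat_of_bool (d _ _ != 0));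
  exact: val_inj.
Qed.

Lemma char_poly_conj (F : fieldType) n (P A : 'M[F]_n) :
  P \in unitmx -> char_poly (invmx P *m A *m P) = char_poly A.
Proof.
move=> uP; rewrite /char_poly /char_poly_mx.
have -> : 'X%:M - map_mx polyC (invmx P *m A *m P) =
  map_mx polyC (invmx P) *m ('X%:M - map_mx polyC A) *m map_mx polyC P.
  rewrite mulmxBr mulmxBl -!map_mxM; congr (_ - _).
  by rewrite scalar_mxC -mulmxA -map_mxM mulVmx // map_mx1 mulmx1.
rewrite !det_mulmx mulrC mulrA -det_mulmx -map_mxM mulmxV //.
by rewrite map_mx1 det1 mul1r.
Qed.

(** The spectral theorem for the Gram matrix, in the form in which singular values
    need it: all roots are real and nonnegative, and the algebraic multiplicity
    of 0 is the corank.  The diagonalization is done by a unitary [P] over [R[i]];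
    each diagonal entry is the squared norm of a row of [P M]. *)
Lemma char_poly_gram (R : rcfType) m n (M : 'M[R]_(m, n)) :
  exists s : seq R, [/\ char_poly (M *m M^T) = \prod_(x <- s) ('X - x%:P),
    size s = m, all (>= 0) s & count (predC1 0) s = \rank M].
Proof.
pose A := M *m M^T; pose iota : {rmorphism R -> R[i]} := real_complex R.
pose B := map_mx iota A.
have Bsym : B \is hermsymmx.
  apply: realsym_hermsym.
    apply/is_hermitianmxP; rewrite expr0 scale1r map_mx_id // /B.
    by rewrite map_trmx trmx_mul trmxK.
  by apply/mxOverP => i j; rewrite mxE complex_real.
have Bn := hermitian_normalmx Bsym.
have /mxOverP dreal := hermitian_spectral_diag_real Bsym.
set P := spectralmx B; set d := spectral_diag B.
have BE : B = invmx P *m diag_mx d *m P by apply/orthomx_spectralP.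
have uP : P \in unitmx by exact: spectral_unit.
(* [M] is real, so [B] is also [M] times its conjugate transpose. *)
have DE : diag_mx d = (P *m map_mx iota M) *m (P *m map_mx iota M)^t*%sesqui.
  rewrite trmx_mul map_mxM mulmxA -(mulmxA P).
  rewrite (_ : map_mx iota M *m _ = B); last first.
    rewrite /B /A map_mxM; congr (_ *m _).
    apply/matrixP => i j; rewrite !mxE; apply/CrealP; by rewrite complex_real.
  rewrite -invmx_unitary ?spectral_unitarymx // -/P BE.
  by rewrite !mulmxA mulmxV // mul1mx mulmxK.
have d_ge0 j : 0 <= d 0 j.
  have /matrixP /(_ j j) := DE; rewrite [LHS]mxE eqxx mulr1n => ->.
  by rewrite mxE sumr_ge0 // => i _; rewrite !mxE mul_conjC_ge0.
have dE j : iota (complex.Re (d 0 j)) = d 0 j by exact: RRe_real.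
exists [seq complex.Re (d 0 j) | j <- enum 'I_m]; split.
- apply: (map_poly_inj iota); rewrite map_char_poly -/B BE char_poly_conj //.
  rewrite char_poly_trig ?diag_mx_is_trig // rmorph_prod big_map big_enum.
  apply: eq_bigr => i _; rewrite rmorphB /= map_polyX map_polyC /= dE.
  by rewrite mxE eqxx mulr1n.
- by rewrite size_map size_enum_ord.
- by apply/allP => _ /mapP[j _ ->]; rewrite -lecR; rewrite dE.
- rewrite -mxrank_gram -/A -(mxrank_map iota) -/B BE.
  rewrite mxrankMfree ?row_free_unit // -mxrank_tr trmx_mul mxrankMfree.
    rewrite mxrank_tr mxrank_diag count_map -sum1_count big_mkcond big_enum.
    apply: eq_bigr => j _ /=; rewrite -dE fmorph_eq0 dE.
    by case: (_ == 0).
  by rewrite row_free_unit unitmx_tr unitmx_inv.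
Qed.

(** In a decreasing list of nonnegative numbers the nonzero ones come first. *)
Lemma nth_gt0_sorted (R : realDomainType) (s : seq R) i : sorted >=%R s -> all (>= 0) s ->
  (0 < nth 0 s i) = (i < count (predC1 0%R) s)%N.
Proof.
elim: s i => [|x s IH] i; first by rewrite nth_nil ltxx.
rewrite sorted_pairwise; last exact: rev_trans le_trans.
rewrite /= -sorted_pairwise; last exact: rev_trans le_trans.
move=> /andP[xs ss] /andP[x0 s0].
have [x_eq0|xN0] /= := eqVneq x 0; last first.
  by case: i => [|i] /=; [rewrite lt0r xN0 x0 | rewrite IH].
have sz y : y \in s -> y = 0.
  move=> ys; apply/eqP; rewrite eq_le; apply/andP; split; last exact: (allP s0 y ys).
  by rewrite -x_eq0; exact: (allP xs y ys).
rewrite (_ : count _ s = 0%N); last first.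
  by apply/eqP; rewrite -leqn0 leqNgt -has_count; apply/hasPn => y /sz ->; rewrite /= eqxx.
rewrite addn0 ltn0 x_eq0; case: i => [|i] /=; first by rewrite ltxx.
have [si|si] := ltnP i (size s); last by rewrite nth_default // ltxx.
by rewrite (sz (nth 0 s i)) ?ltxx ?mem_nth.
Qed.

Section singular_values.
Variable R : realType.

Lemma sorted_real_eigenvalues m (A : 'M[R]_m) : sorted >=%R (real_eigenvalues A).
Proof.
rewrite /real_eigenvalues.
have : sorted >%R (rev (rootsR (char_poly A))).
  by rewrite rev_sorted; exact: sorted_roots.
have gt_trans : transitive (>%R : rel R) by move=> x y z xy /lt_trans; apply.
elim: (rev _) => //= x s IH; rewrite path_sortedE // => /andP[xs /IH].
have rt : transitive (>=%R : rel R) by exact: rev_trans le_trans.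
rewrite !sorted_pairwise // pairwise_cat => ->; rewrite andbT.
apply/andP; split; last first.
  by elim: (mup _ _) => //= k ->; rewrite andbT; apply/allP => y /nseqP[-> _] /=.
apply/allrelP => y z /nseqP[-> _] /flattenP[_ /mapP[w ws ->]] /nseqP[-> _].
exact/ltW/(allP xs).
Qed.

Lemma real_eigenvalues_prod m (A : 'M[R]_m) (s : seq R) :
  char_poly A = \prod_(x <- s) ('X - x%:P) -> perm_eq (real_eigenvalues A) s.
Proof.
move=> As; apply/allP => /= x _; apply/eqP.
have pN0 : char_poly A != 0 by rewrite monic_neq0 ?char_poly_monic.
rewrite -(mu_prod_XsubC x s) -As /real_eigenvalues.
have xr : (x \in rootsR (char_poly A)) = root (char_poly A) x.
  by rewrite -roots_on_rootsR // in_itv.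
have ur : uniq (rootsR (char_poly A)).
  exact: sorted_uniq lt_trans ltxx _ (sorted_roots _ _ _).
rewrite count_flatten -map_comp sumnE big_map big_rev /=.
have [rx|Nrx] := boolP (root (char_poly A) x); last first.
  rewrite mupNroot // big_seq big1 // => y; rewrite count_nseq /=.
  by have [->|//] := eqVneq y x; rewrite xr (negPf Nrx).
rewrite (bigD1_seq x) ?xr //= count_nseq /= eqxx mul1n big1 ?addn0 // => y yx.
by rewrite count_nseq /= (negPf yx).
Qed.

(** This is how the comparisons of the algorithm become statements about rank. *)
Lemma singular_value_gt0 k m n (M : 'M[R]_(m, n)) : (0 < k)%N ->
  (0 < singular_value k M) = (k <= \rank M)%N.
Proof.
move=> k0; rewrite /singular_value; case: ifPn => [kmn|]; last first.
  rewrite ltxx -ltnNge => kmn; apply/esym/negbTE; rewrite -ltnNge.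
  by apply: leq_ltn_trans kmn; rewrite leq_min rank_leq_row rank_leq_col.
have [s [sE _ s0 <-]] := char_poly_gram M.
have /seq.permP es := real_eigenvalues_prod sE.
rewrite sqrtr_gt0 nth_gt0_sorted ?sorted_real_eigenvalues //.
  by rewrite es; case: k k0 {kmn}.
by rewrite (perm_all _ (real_eigenvalues_prod sE)).
Qed.

Lemma singular_value_eq0 k m n (M : 'M[R]_(m, n)) :
  (\rank M < k)%N -> singular_value k M = 0.
Proof.
move=> Mk; have k0 : (0 < k)%N by apply: leq_trans Mk.
apply/eqP; rewrite eq_le leNgt singular_value_gt0 // -ltnNge Mk.
by rewrite /singular_value; case: ifP => _; rewrite ?sqrtr_ge0 ?lexx.
Qed.
End singular_values.

(** * Cutting a tensor train at a bond *)

Section transfer.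
Variables (R : realType) (s : nat -> nat).
Implicit Type E : nat -> nat -> nat -> R.

(** A tensor train is a product of matrices between two 1-dimensional spaces, so it
    can be evaluated by pushing a row vector from the left or a column vector from
    the right.  The factors are kept as functions of natural number indices: the
    matrix sizes [s j] depend on the position, and bounding the sums by [s]
    makes casts unnecessary. *)
Fixpoint left_vec E m (b : nat) : R :=
  if m is m'.+1 then \sum_(k < s m') left_vec E m' k * E m' k b else (b == 0%N)%:R.

Fixpoint right_vec E l j (a : nat) : R :=
  if l is l'.+1 then \sum_(k < s j.+1) E j a k * right_vec E l' j.+1 k
  else (a == 0%N)%:R.

(** Cutting the product at bond [j] writes it as a sum of [s j] terms. *)
Lemma left_vec_right_vec E l j : (0 < s (l + j))%N ->
  left_vec E (l + j) 0 = \sum_(k < s j) left_vec E j k * right_vec E l j k.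
Proof.
elim: l j => [|l IH] j sj.
  rewrite (bigD1 (Ordinal sj)) //= mulr1 big1 ?addr0 // => k k0.
  by rewrite (_ : (k == 0 :> nat) = false) ?mulr0 //; apply: contraNF k0 => /eqP k0;
    apply/eqP/val_inj.
rewrite addSnnS IH -?addSnnS //=.
under eq_bigr do rewrite mulr_suml.
rewrite exchange_big; apply: eq_bigr => k _ /=.
by rewrite mulr_sumr; apply: eq_bigr => i _; rewrite mulrA.
Qed.

Lemma eq_left_vec E E' m b : (forall j, (j < m)%N -> E j = E' j) ->
  left_vec E m b = left_vec E' m b.
Proof.
elim: m b => //= m IH b EE'; apply: eq_bigr => k _.
by rewrite IH ?EE' // => j jm; rewrite EE' // ltnW.
Qed.

Lemma eq_right_vec E E' l j a : (forall i, (j <= i < l + j)%N -> E i = E' i) ->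
  right_vec E l j a = right_vec E' l j a.
Proof.
elim: l j a => //= l IH j a EE'; apply: eq_bigr => k _.
rewrite EE' ?leqnn ?addSn ?ltnS ?leq_addl // IH // => i /andP[ji il].
by rewrite EE' // ltnW //= addSnnS.
Qed.

Lemma mx_chain_left_vec E (A : forall j, 'M[R]_(s j, s j.+1)) m (a : 'I_(s 0%N)) b :
  (forall j k l, A j k l = E j k l) -> a = 0%N :> nat ->
  mx_chain A m a b = left_vec E m b.
Proof.
move=> AE a0; elim: m b => [|m IH] b /=.
  by rewrite !mxE -val_eqE /= a0 eq_sym.
by rewrite mxE; apply: eq_bigr => k _; rewrite IH AE.
Qed.

End transfer.

Section entries.
Variable R : nzRingType.

(** Reading entries by natural numbers, with value 0 out of range, absorbs the
    casts along the equality of [tau^-1 (tau p)] and [p]. *)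
Definition nat_entry m n (B : 'M[R]_(m, n)) (a b : nat) : R :=
  if insub a is Some a' then if insub b is Some b' then B a' b' else 0 else 0.

Lemma nat_entryE m n (B : 'M[R]_(m, n)) (a : 'I_m) (b : 'I_n) : nat_entry B a b = B a b.
Proof. by rewrite /nat_entry !valK. Qed.

Lemma conform_nat_entry m n m' n' (B : 'M[R]_(m', n')) (a : 'I_m) (b : 'I_n) :
  m' = m -> n' = n -> conform_mx 0 B a b = nat_entry B a b.
Proof. by move=> em en; case: _ / em a; case: _ / en b => b a; rewrite conform_mx_id nat_entryE. Qed.
End entries.

Section tensor.
Variables (R : realType) (d : nat) (n r : d.-tuple nat) (tau : 'S_d).
Notation pos i := (nat_of_ord (tau^-1%g i)).
Implicit Types (u : tt_params R n r tau) (x y : multi_index n).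

Definition tt_entry (u : tt_params R n r tau) (x : multi_index n) (j a b : nat) : R :=
  if insub j is Some p then nat_entry (u (tau p) (x (tau p))) a b else 0.

Lemma tt_factor_entry u x j a b : tt_factor u x j a b = tt_entry u x j a b.
Proof.
rewrite /tt_factor /tt_entry; case: insubP => [p _ pj|]; last by rewrite mxE.
by apply: conform_nat_entry; rewrite permK pj.
Qed.

Lemma tt_entry_local u x x' j :
  (forall i, pos i = j -> x i = x' i) -> tt_entry u x j = tt_entry u x' j.
Proof.
move=> xx'; apply/funext => a; apply/funext => b; rewrite /tt_entry.
by case: insubP => // p _ pj; rewrite xx' // permK.
Qed.

Hypotheses (d_gt0 : (0 < d)%N) (r_first : forall j : 'I_d, val j = 0%N -> tnth r j = 1%N).

Lemma bond0 : bond r 0 = 1%N.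
Proof.
by rewrite /bond mod0n -(r_first (j := Ordinal d_gt0)) // (tnth_nth 0%N).
Qed.

Lemma bondd : bond r d = 1%N.
Proof. by rewrite /bond modnn -bond0 /bond mod0n. Qed.

Lemma tt_tensor_left_vec u x :
  tt_tensor u x = left_vec (bond r) (tt_entry u x) d 0.
Proof.
rewrite /tt_tensor conform_nat_entry ?bond0 ?bondd //.
have b0 : (0 < bond r 0)%N by rewrite bond0.
have bd : (0 < bond r d)%N by rewrite bondd.
rewrite (nat_entryE _ (Ordinal b0) (Ordinal bd)).
by rewrite (mx_chain_left_vec (E := tt_entry u x)) // => j k l; exact: tt_factor_entry.
Qed.

Lemma tt_tensor_split u x j : (j <= d)%N ->
  tt_tensor u x = \sum_(k < bond r j) left_vec (bond r) (tt_entry u x) j k *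
    right_vec (bond r) (tt_entry u x) (d - j) j k.
Proof.
move=> jd; rewrite tt_tensor_left_vec -left_vec_right_vec subnK //.
by rewrite bondd.
Qed.

Lemma dfwithC (y : multi_index n) (i j : 'I_d) a b : i != j ->
  dfwith (dfwith y i a) j b = dfwith (dfwith y j b) i a.
Proof.
move=> ij; apply: functional_extensionality_dep => k.
have [jk|jk] := eqVneq j k.
  by case: _ / jk; rewrite dfwithin dfwithout // dfwithin.
have [ik|ik] := eqVneq i k; last by rewrite !dfwithout.
by case: _ / ik; rewrite dfwithin dfwithout ?dfwithin // eq_sym.
Qed.

Lemma dfwith_rot (y : multi_index n) (i j k : 'I_d) a b e : i != j -> i != k ->
  dfwith (dfwith (dfwith y i a) j b) k e = dfwith (dfwith (dfwith y j b) k e) i a.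
Proof. by move=> ij ik; rewrite (dfwithC y _ _ ij) (dfwithC _ _ _ ik). Qed.

(** If [i] lies to one side of both [j] and [k], cut the train at the bond of [i]
    facing them.  One factor then depends only on the index at [i] and the other
    only on the indices at [j] and [k], so the rank is at most that bond, which
    is an inner one and hence smaller than [rho]. *)
Lemma rank_end_site u y (i j k : 'I_d) rho :
  (forall p : 'I_d, (0 < p)%N -> (tnth r p < rho)%N) ->
  i != j -> i != k -> j != k ->
  (pos i < pos j)%N && (pos i < pos k)%N || (pos j < pos i)%N && (pos k < pos i)%N ->
  (\rank (matricization (tt_tensor u) y i j k) < rho)%N.
Proof.
move=> r_lt ij ik jk ends.
have bond_lt m : (0 < m < d)%N -> (bond r m < rho)%N.
  case/andP=> m0 md; rewrite /bond modn_small //.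
  by rewrite -(tnth_nth 0%N r (Ordinal md)); exact: r_lt.
suff [m md [P [Q ->]]] : exists2 m, (0 < m < d)%N &
    exists (P : 'M[R]_(tnth n i, bond r m)) (Q : 'M[R]_(bond r m, tnth n j * tnth n k)),
    matricization (tt_tensor u) y i j k = P *m Q.
  apply: leq_ltn_trans (mxrankM_maxl _ _) _.
  exact: leq_ltn_trans (rank_leq_col _) (bond_lt _ md).
case/orP: ends => /andP[ij' ik'].
- exists (pos i).+1; first by exact: (leq_ltn_trans ij' (ltn_ord _)).
  exists (\matrix_(a, c) left_vec (bond r) (tt_entry u (dfwith y i a)) (pos i).+1 c).
  exists (\matrix_(c, l) mxvec (\matrix_(b, e)
     right_vec (bond r) (tt_entry u (dfwith (dfwith y j b) k e)) (d - (pos i).+1) (pos i).+1 c) 0 l).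
  apply/matrixP => a l; case/mxvec_indexP: l => b e; rewrite !mxE mxvecE mxE.
  rewrite (tt_tensor_split _ _ (j := (pos i).+1)) //.
  apply: eq_bigr => c _; rewrite !mxE mxvecE mxE; congr (_ * _).
    apply: eq_left_vec => m mi; apply: tt_entry_local => q qm.
    have notin l : (pos i < pos l)%N -> l != q.
      by move=> il; apply: contraTneq mi => lq; rewrite -qm -lq ltnS -ltnNge.
    by rewrite [LHS]dfwithout ?notin // [LHS]dfwithout ?notin.
  apply: eq_right_vec => m /andP[im _]; apply: tt_entry_local => q qm.
  rewrite dfwith_rot // dfwithout //; apply: contraTneq im => iq.
  by rewrite -qm -iq ltnn.
- exists (pos i); first by rewrite (leq_ltn_trans _ ij') /=.
  exists (\matrix_(a, c) right_vec (bond r) (tt_entry u (dfwith y i a)) (d - pos i) (pos i) c).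
  exists (\matrix_(c, l) mxvec (\matrix_(b, e)
     left_vec (bond r) (tt_entry u (dfwith (dfwith y j b) k e)) (pos i) c) 0 l).
  apply/matrixP => a l; case/mxvec_indexP: l => b e; rewrite !mxE mxvecE mxE.
  rewrite (tt_tensor_split _ _ (j := pos i)) 1?ltnW //.
  apply: eq_bigr => c _; rewrite !mxE mxvecE mxE mulrC; congr (_ * _).
    apply: eq_right_vec => m /andP[im _]; apply: tt_entry_local => q qm.
    have notin l : (pos l < pos i)%N -> l != q.
      by move=> il; apply: contraTneq im => lq; rewrite -qm -lq -ltnNge.
    by rewrite [LHS]dfwithout ?notin // [LHS]dfwithout ?notin.
  apply: eq_left_vec => m mi; apply: tt_entry_local => q qm.
  rewrite dfwith_rot // dfwithout //; apply: contraTneq mi => iq.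
  by rewrite -qm -iq ltnn.
Qed.
End tensor.

(** * A nonvanishing minor at the middle site *)

(** When every factor maps the basis vector reached so far to a basis vector or to
    0, the transfer vector stays a 0/1 multiple of a basis vector: [c m] is the
    basis index at bond [m], and [alive m] tells whether it has survived. *)
Lemma left_vec_path (R : realType) (s : nat -> nat) (E : nat -> nat -> nat -> R)
    (alive : nat -> bool) (c : nat -> nat) m b :
  alive 0%N -> c 0%N = 0%N -> (forall j, (j < m)%N -> (c j < s j)%N) ->
  (forall j k, (j < m)%N -> (k < s j.+1)%N ->
    (alive j)%:R * E j (c j) k = (alive j.+1 && (k == c j.+1))%:R) ->
  (b < s m)%N -> left_vec s E m b = (alive m && (b == c m))%:R.
Proof.
move=> a0 c0; elim: m b => [|m IH] b cs EE bs /=; first by rewrite a0 c0.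
rewrite -EE // (bigD1 (Ordinal (cs m (ltnSn m)))) //= big1 => [|k kc].
  rewrite addr0 IH ?eqxx ?andbT //.
  - by move=> j jm; exact: (cs _ (leqW jm)).
  - by move=> j k jm; apply: EE; exact: leqW.
  - exact: cs.
have kcm : (val k == c m) = false.
  by apply: contraNF kc => /eqP kc; apply/eqP/val_inj.
rewrite IH ?ltn_ord //; first by rewrite /= in kcm *; rewrite kcm andbF mul0r.
- by move=> j jm; exact: (cs _ (leqW jm)).
- by move=> j i jm; exact: (EE _ _ (leqW jm)).
Qed.

Lemma nat_entry_matrix (R : realType) m n (f : nat -> nat -> R) a b :
  (a < m)%N -> (b < n)%N -> nat_entry (\matrix_(i < m, j < n) f i j) a b = f a b.
Proof. by move=> am bn; rewrite (nat_entryE _ (Ordinal am) (Ordinal bn)) mxE. Qed.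

(** The path followed at the witness below.  Basis vector 0 enters at [p1], where it
    is replaced by the index [a] read there; [a] travels to [p2], where it must be
    the quotient of [x] by [rho] and is replaced by the remainder; the remainder
    travels to [p3], where it must be the index [e] read there. *)
Lemma path_step (rho p1 p2 p3 j k a e x X : nat) : (p1 < p2)%N -> (p2 < p3)%N ->
  (j = p1 -> X = a) -> (j = p2 -> X = x) -> (j = p3 -> X = e) ->
  let alive m := ((m <= p2) || (a == x %/ rho))%N && ((m <= p3) || (e == x %% rho))%N in
  let c m := (if m <= p1 then 0 else if m <= p2 then a
    else if m <= p3 then x %% rho else 0)%N in
  let rel a b := if j == p2 then ((a == X %/ rho) && (b == X %% rho))%N
    else if j == p3 then (a == X) && (b == 0%N)
    else if j == p1 then b == X
    else if (p1 < j < p3)%N then a == b else b == 0%N in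
  alive j && rel (c j) k = alive j.+1 && (k == c j.+1).
Proof.
move=> p12 p23; set q := (x %/ rho)%N; set w := (x %% rho)%N => /=.
case: (ltngtP j p2) => jp2 H1 H2 H3 /=.
- have -> : (j <= p3)%N by lia.
  have -> : (j < p3)%N by lia.
  have -> : (j == p3) = false by lia.
  case: (ltngtP j p1) H1 => //= jp1 H1; last by rewrite H1.
- have -> : (j <= p1)%N = false by lia.
  have -> : (j == p1) = false by lia.
  have -> : (j < p1)%N = false by lia.
  have -> : (p1 < j)%N by lia.
  case: (ltngtP j p3) H3 => /= jp3 H3; [by rewrite (eq_sym w) | by [] | ].
  by rewrite H3 // (eq_sym w) andbT andbA.
- have -> : (j <= p1)%N = false by lia.
  have -> : (j < p1)%N = false by lia.
  have -> : (j <= p3)%N by lia.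
  have -> : (j < p3)%N by lia.
  by rewrite H2 // !andbT.
Qed.

Section witness.
Variables (R : realType) (d : nat) (n r : d.-tuple nat) (tau : 'S_d) (rho : nat).
Notation pos i := (nat_of_ord (tau^-1%g i)).
Hypotheses (d_gt0 : (0 < d)%N)
  (r_gt0 : forall j : 'I_d, (0 < tnth r j)%N)
  (r_first : forall j : 'I_d, nat_of_ord j = 0%N -> tnth r j = 1%N)
  (rho_gt0 : (0 < rho)%N)
  (r_ge : forall j : 'I_d, (0 < j)%N -> (rho <= tnth r j)%N).

Lemma bond_gt0 j : (0 < bond r j)%N.
Proof.
have jd : (j %% d < d)%N by rewrite ltn_mod.
by rewrite /bond -(tnth_nth 0%N r (Ordinal jd)).
Qed.

Lemma bond_ge j : (0 < j < d)%N -> (rho <= bond r j)%N.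
Proof.
case/andP=> j0 jd; rewrite /bond modn_small //.
by rewrite -(tnth_nth 0%N r (Ordinal jd)); exact: r_ge.
Qed.

Variables lo mi hi : 'I_d.

(** The 0/1 pattern of the factor at position [p] with physical index [x].  The site
    [mi] decodes its index in base [rho], so that it can be compared with the pair
    of indices at [lo] and [hi]: this is what makes its matricization an identity
    matrix of size [rho ^ 2]. *)
Definition witness_rel (p x a b : nat) : bool :=
  if p == pos mi then ((a == x %/ rho) && (b == x %% rho))%N
  else if p == pos hi then (a == x) && (b == 0%N)
  else if p == pos lo then b == x
  else if (pos lo < p < pos hi)%N then a == b
  else b == 0%N.

Definition witness : tt_params R n r tau :=
  fun i x => \matrix_(a, b) (witness_rel (pos i) x a b)%:R.

Lemma witness_entry (x : multi_index n) (p : 'I_d) a b :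
  (a < bond r p)%N -> (b < bond r p.+1)%N ->
  tt_entry witness x p a b = (witness_rel p (x (tau p)) a b)%:R.
Proof.
move=> ap bp; rewrite /tt_entry valK.
pose f a b : R := (witness_rel (pos (tau p)) (x (tau p)) a b)%:R.
by apply: etrans (nat_entry_matrix f _ _) _; rewrite /f permK.
Qed.

Hypotheses (lo_mi : (pos lo < pos mi)%N) (mi_hi : (pos mi < pos hi)%N).

Lemma witness_tensor (x : multi_index n) : (x lo < rho)%N -> (x hi < rho)%N ->
  tt_tensor witness x =
    ((x lo == x mi %/ rho :> nat) && (x hi == x mi %% rho :> nat))%N%:R.
Proof.
move=> xlo xhi; rewrite tt_tensor_left_vec //.
pose alive m := ((m <= pos mi) || (x lo == x mi %/ rho :> nat))%N &&
  ((m <= pos hi) || (x hi == x mi %% rho :> nat))%N.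
pose c m : nat := (if m <= pos lo then 0 else if m <= pos mi then nat_of_ord (x lo)
  else if m <= pos hi then x mi %% rho else 0)%N.
have c_lt j : (j < d)%N -> (c j < bond r j)%N.
  move=> jd; rewrite /c.
  case: (leqP j (pos lo)) => [_|loj]; first exact: bond_gt0.
  have j0 : (0 < j < d)%N by rewrite (leq_trans _ loj).
  case: (leqP j (pos mi)) => _; first exact: leq_trans (bond_ge j0).
  case: (leqP j (pos hi)) => _; last exact: bond_gt0.
  by apply: leq_trans (bond_ge j0); rewrite ltn_mod.
rewrite (@left_vec_path _ _ _ alive c).
- have d_gt i : (d <= pos i)%N = false by rewrite leqNgt ltn_ord.
  by rewrite /alive /c !d_gt /= eqxx andbT.
- by rewrite /alive.
- by rewrite /c.
- exact: c_lt.
- move=> j k jd kd; have cj := c_lt _ jd.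
  rewrite (witness_entry x (p := Ordinal jd)) //= -natrM mulnb; congr (nat_of_bool _)%:R.
  rewrite /witness_rel /alive /c.
  have X i : j = pos i -> nat_of_ord (x (tau (Ordinal jd))) = x i.
    by move=> ji; rewrite (_ : tau _ = i) //; apply: (canLR (permKV tau)); exact: val_inj.
  move: (X lo) (X mi) (X hi) => {X}.
  move: (nat_of_ord (x (tau (Ordinal jd)))) => X Xlo Xmi Xhi.
  exact: path_step.
- by rewrite bondd.
Qed.

Variable y : multi_index n.

(** Rows are the first [rho ^ 2] indices at [mi]; column [l] is the pair of base
    [rho] digits of [l], used as indices at [lo] and [hi].  The default value
    of [insubd] is never reached under the size assumptions below. *)
Definition minor (u : tt_params R n r tau) : 'M[R]_(rho ^ 2) :=
  \matrix_(k, l) tt_tensor u (dfwith (dfwith (dfwith y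
     mi (insubd (y mi) (nat_of_ord k)))
     lo (insubd (y lo) (l %/ rho)%N))
     hi (insubd (y hi) (l %% rho)%N)).

Hypotheses (n_lo : (rho <= tnth n lo)%N) (n_mi : (rho ^ 2 <= tnth n mi)%N)
  (n_hi : (rho <= tnth n hi)%N).

Lemma minor_witness : minor witness = 1%:M.
Proof.
have lm : lo != mi by apply: contraTneq lo_mi => ->; rewrite ltnn.
have mh : mi != hi by apply: contraTneq mi_hi => ->; rewrite ltnn.
have lh : lo != hi by apply: contraTneq (ltn_trans lo_mi mi_hi) => ->; rewrite ltnn.
apply/matrixP => k l; rewrite !mxE.
have l1 : (l %/ rho < rho)%N by rewrite ltn_divLR // -expnSr.
have l2 : (l %% rho < rho)%N by rewrite ltn_mod.
set x := dfwith _ _ _.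
have xhi : x hi = (l %% rho)%N :> nat.
  by rewrite /x dfwithin insubdK // /in_mem /= (leq_trans l2).
have xlo : x lo = (l %/ rho)%N :> nat.
  by rewrite /x dfwithout ?dfwithin 1?eq_sym // insubdK // /in_mem /= (leq_trans l1).
have xmi : x mi = k :> nat.
  rewrite /x dfwithout 1?eq_sym // dfwithout // dfwithin insubdK //.
  by rewrite /in_mem /= (leq_trans (ltn_ord k)).
rewrite witness_tensor ?xhi ?xlo // xmi; congr (nat_of_bool _)%:R.
apply/andP/eqP => [[/eqP q /eqP w]|->]; last by rewrite !eqxx.
by apply: val_inj; rewrite /= (divn_eq k rho) (divn_eq l rho) q w.
Qed.

(** The minor sits inside both matricizations at [mi], since exchanging the two
    other sites only permutes columns. *)
Lemma rank_middle_site u : \det (minor u) != 0 ->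
  (rho ^ 2 <= \rank (matricization (tt_tensor u) y mi lo hi))%N /\
  (rho ^ 2 <= \rank (matricization (tt_tensor u) y mi hi lo))%N.
Proof.
rewrite -unitfE -unitmxE => /mxrank_unit rk.
have lh : lo != hi by apply: contraTneq (ltn_trans lo_mi mi_hi) => ->; rewrite ltnn.
pose f (k : 'I_(rho ^ 2)) := insubd (y mi) (nat_of_ord k).
pose a (l : 'I_(rho ^ 2)) := insubd (y lo) (l %/ rho)%N.
pose b (l : 'I_(rho ^ 2)) := insubd (y hi) (l %% rho)%N.
have rank_sub m (g : 'I_(rho ^ 2) -> 'I_m) (M : 'M[R]_(tnth n mi, m)) :
    minor u = mxsub f g M -> (rho ^ 2 <= \rank M)%N.
  move=> mE; rewrite -{1}rk mE mxsubrc.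
  apply: leq_trans (mxrankS (rowsub_sub _ _)) _.
  by rewrite -mxrank_tr trmx_mxsub -[leqRHS]mxrank_tr (mxrankS (rowsub_sub _ _)).
split.
- apply: (rank_sub _ (fun l => mxvec_index (a l) (b l))).
  by apply/matrixP => k l; rewrite !mxE mxvecE mxE.
- apply: (rank_sub _ (fun l => mxvec_index (b l) (a l))).
  by apply/matrixP => k l; rewrite !mxE mxvecE mxE; congr tt_tensor; exact: dfwithC.
Qed.
End witness.

(** * The exceptional set of parameters *)

Section null.
Variables (R : realType) (d : nat) (n r : d.-tuple nat) (tau : 'S_d).
Notation pos i := (nat_of_ord (tau^-1%g i)).
Notation coord := (tt_coord_index n r tau).

Definition tt_of_coords (t : #|{: coord}|.-tuple (measurableTypeR R)) : tt_params R n r tau :=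
  fun i x => \matrix_(a, b) tnth t (enum_rank
    (existT _ i (x, a, b) : coord)).

Lemma tt_coordsK : cancel (@tt_coords R d n r tau) tt_of_coords.
Proof.
move=> u; apply: functional_extensionality_dep => i; apply/funext => x.
by apply/matrixP => a b; rewrite /tt_of_coords mxE tnth_mktuple enum_rankK.
Qed.

Lemma polyfun_tt_entry x j a b :
  polyfun (fun t => tt_entry (tt_of_coords t) x j a b).
Proof.
rewrite /tt_entry; case: insub => [p|]; last exact: polyfun_cst.
rewrite /nat_entry; case: insub => [a'|]; last exact: polyfun_cst.
case: insub => [b'|]; last exact: polyfun_cst.
under eq_fun do rewrite /tt_of_coords mxE; exact: polyfun_coord.
Qed.

Hypotheses (d_gt0 : (0 < d)%N)
  (r_first : forall j : 'I_d, nat_of_ord j = 0%N -> tnth r j = 1%N).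

Lemma polyfun_tt_tensor x : polyfun (fun t => tt_tensor (tt_of_coords t) x).
Proof.
under eq_fun do rewrite tt_tensor_left_vec //.
suff poly_left m b : polyfun (fun t =>
    left_vec (bond r) (tt_entry (tt_of_coords t) x) m b) by exact: poly_left.
elim: m b => [|m IH] b /=; first exact: polyfun_cst.
by apply: polyfun_sum => k; apply: polyfun_mul; [exact: IH | exact: polyfun_tt_entry].
Qed.

(** Nullity is defined through the coordinates of the parameters, in which entries of
    the tensor are polynomial functions. *)
Lemma tt_null_polyfun (P : tt_params R n r tau -> R) :
  polyfun (fun t => P (tt_of_coords t)) -> (exists u, P u != 0) ->
  tt_null [set u | P u = 0].
Proof.
move=> pP [u Pu].
pose Z : set (#|{: coord}|.-tuple (measurableTypeR R)) := [set t | P (tt_of_coords t) = 0].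
apply: (@negligibleS _ _ _ _ Z).
  by move=> _ [v /= Pv <-]; rewrite /Z /= tt_coordsK.
apply/negligibleP; last first.
  by apply: (polyfun_zeros_null (t0 := tt_coords u)) => //; rewrite tt_coordsK.
rewrite -[X in measurable X]setTI.
exact: (measurable_polyfun pP measurableT (measurable_set1 (0 : R))).
Qed.

Lemma tt_null_bigcup (I : countType) (D : set I) (F : I -> set (tt_params R n r tau)) :
  (forall i, D i -> tt_null (F i)) -> tt_null (\bigcup_(i in D) F i).
Proof.
move=> nF; rewrite /tt_null image_bigcup.
pose G k := if unpickle k is Some i then
  if pselect (D i) then (@tt_coords R d n r tau) @` F i else set0 else set0.
apply: (@negligibleS _ _ _ _ (\bigcup_k G k)).
  move=> t [i Di Ft]; exists (pickle i) => //; rewrite /G pickleK.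
  by case: pselect.
apply: negligible_bigcup => k; rewrite /G; case: unpickle => [i|]; last exact: negligible_set0.
by case: pselect => Di; [exact: nF | exact: negligible_set0].
Qed.
End null.

Definition between (a b c : nat) := ((a < b < c) || (c < b < a))%N.

Section generic.
Variables (R : realType) (d : nat) (n r : d.-tuple nat) (tau : 'S_d) (rho : nat).
Notation pos i := (nat_of_ord (tau^-1%g i)).
Hypotheses (d_ge3 : (3 <= d)%N)
    (n_gt0 : forall i : 'I_d, (0 < tnth n i)%N)
    (r_gt0 : forall j : 'I_d, (0 < tnth r j)%N)
    (r_first : forall j : 'I_d, nat_of_ord j = 0%N -> tnth r j = 1%N)
    (rho_gt0 : (0 < rho)%N)
    (n_ends : forall j : 'I_d, nat_of_ord j = 0%N \/ nat_of_ord j = d.-1 ->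
      (rho <= tnth n (tau j))%N)
    (n_middle : forall j : 'I_d, (0 < j < d.-1)%N ->
      (rho ^ 2 <= tnth n (tau j))%N)
    (r_bounds : forall j : 'I_d, (0 < j)%N -> (rho <= tnth r j < rho ^ 2)%N).

Lemma n_ge i : (rho <= tnth n i)%N.
Proof.
rewrite -(permKV tau i); set j := tau^-1%g i.
have [j0|j0] := posnP j; first by apply: n_ends; left.
have [jd|jd] := ltnP j d.-1; last first.
  by apply: n_ends; right; apply/eqP; rewrite eqn_leq jd andbT -ltnS prednK ?ltn_ord // (leq_trans _ d_ge3).
by apply: leq_trans (n_middle _); rewrite ?j0 ?jd // leq_pmulr.
Qed.

(** The exceptional set depends on the samples only through their values, so it is
    a union over the finite type of all multi-indices; this is why one null set
    serves every run of the algorithm.  Finite functions are used because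
    the type of multi-indices itself carries no countable structure. *)
Definition degenerate : set (tt_params R n r tau) :=
  \bigcup_(w in [set w : 'I_d * 'I_d * 'I_d * {dffun forall i : 'I_d, 'I_(tnth n i)} |
     (pos w.1.1.1 < pos w.1.1.2 < pos w.1.2)%N])
    [set u | \det (minor rho w.1.1.1 w.1.1.2 w.1.2 (fun i => w.2 i) u) = 0].

Lemma tt_null_degenerate : tt_null degenerate.
Proof.
have d_gt0 : (0 < d)%N by rewrite (leq_trans _ d_ge3).
apply: tt_null_bigcup => -[[[lo mi] hi] y] /= /andP[lo_mi mi_hi].
apply: (tt_null_polyfun (P := fun u => \det (minor _ _ _ _ _ u))).
  apply: polyfun_det => k l; under eq_fun do rewrite mxE; exact: polyfun_tt_tensor.
exists (@witness R d n r tau rho lo mi hi).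
rewrite minor_witness ?det1 ?oner_eq0 //.
- by move=> j j0; case/andP: (r_bounds j0).
- exact: n_ge.
- rewrite -(permKV tau mi); apply: n_middle.
  rewrite (leq_ltn_trans _ lo_mi) //= -ltnS prednK // ?(leq_ltn_trans mi_hi) //.
- exact: n_ge.
Qed.

(** Outside the exceptional set the rank test detects betweenness. *)
Lemma generic_rank u y (i j k : 'I_d) : ~ degenerate u ->
  i != j -> i != k -> j != k ->
  (rho ^ 2 <= \rank (matricization (tt_tensor u) y i j k))%N =
  between (pos j) (pos i) (pos k).
Proof.
move=> ndu ij ik jk.
have nd lo mi hi : (pos lo < pos mi)%N -> (pos mi < pos hi)%N -> \det (minor rho lo mi hi y u) != 0.
  move=> h1 h2; apply/eqP => du; apply: ndu.
  exists (lo, mi, hi, [ffun i => y i] : {dffun forall i : 'I_d, 'I_(tnth n i)}) => /=; first by rewrite h1.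
  rewrite (_ : (fun i => _) = y) //.
  by apply: functional_extensionality_dep => l; rewrite ffunE.
have inj a b : a != b -> pos a != pos b by apply: contraNneq => /val_inj /perm_inj ->.
have d_gt0 : (0 < d)%N by rewrite (leq_trans _ d_ge3).
have [mid|] := boolP (between _ _ _).
  by case/orP: mid => /andP[h1 h2]; case: (rank_middle_site h1 h2 (nd _ _ _ h1 h2)).
move=> nmid; apply/negbTE; rewrite -ltnNge.
apply: rank_end_site => //; first by move=> p /r_bounds /andP[].
move: nmid (inj _ _ ij) (inj _ _ ik) (inj _ _ jk).
by rewrite /between; lia.
Qed.
End generic.

(** * Recovery of the order from betweenness *)

Section algo.
Variables (R : realType) (d : nat) (n : d.-tuple nat) (rho : nat).
Variables (T : multi_index n -> R).

(** All that correctness of the recovery needs from the tensor: the three-index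
    test puts the site that is the middle one, for the hidden order [f], in the
    middle.  The property is invariant under reversing [f], as it must be since
    the tensor determines [tau] only up to reversal. *)
Definition middle_oracle (f : 'I_d -> nat) : Prop :=
  forall y i1 i2 i3, i1 != i2 -> i1 != i3 -> i2 != i3 ->
  three_index rho T y i1 i2 i3 =
    if between (f i2) (f i1) (f i3) then Some (i2, i1, i3)
    else if between (f i3) (f i2) (f i1) then Some (i1, i2, i3)
    else Some (i2, i3, i1).

(** Exactly one of the three compared singular values is nonzero, so one strict
    comparison always succeeds. *)
Lemma middle_oracle_rank (f : 'I_d -> nat) : (0 < rho)%N -> injective f ->
  (forall y i j k, i != j -> i != k -> j != k ->
    (rho ^ 2 <= \rank (matricization T y i j k))%N = between (f j) (f i) (f k)) ->
  middle_oracle f.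
Proof.
move=> rho0 fI rkE y i1 i2 i3 i12 i13 i23.
have r2 : (0 < rho ^ 2)%N by rewrite expn_gt0 rho0.
have sv_gt0 i j k : i != j -> i != k -> j != k ->
    (0 < singular_value (rho ^ 2) (matricization T y i j k)) = between (f j) (f i) (f k).
  by move=> ij ik jk; rewrite singular_value_gt0 // rkE.
have sv_eq0 i j k : i != j -> i != k -> j != k -> ~~ between (f j) (f i) (f k) ->
    singular_value (rho ^ 2) (matricization T y i j k) = 0.
  by move=> ij ik jk; rewrite -(rkE y) // -ltnNge => /singular_value_eq0.
have f12 : f i1 != f i2 by rewrite (inj_eq fI).
have f13 : f i1 != f i3 by rewrite (inj_eq fI).
have f23 : f i2 != f i3 by rewrite (inj_eq fI).
have i21 : i2 != i1 by rewrite eq_sym.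
have i31 : i3 != i1 by rewrite eq_sym.
have i32 : i3 != i2 by rewrite eq_sym.
rewrite /three_index /=.
case: (boolP (between (f i2) (f i1) (f i3))) => b1.
  rewrite (sv_eq0 i2 i3 i1) //; last by move: b1; rewrite /between; lia.
  rewrite (sv_eq0 i3 i1 i2) //; last by move: b1; rewrite /between; lia.
  by rewrite maxxx sv_gt0 // b1.
rewrite (sv_eq0 i1 i2 i3) //.
case: (boolP (between (f i3) (f i2) (f i1))) => b2.
  rewrite (sv_eq0 i3 i1 i2) //; last by move: b2; rewrite /between; lia.
  rewrite maxxx sv_gt0 // b2 ifN // -leNgt le_max.
  by rewrite ltW // sv_gt0.
rewrite (sv_eq0 i2 i3 i1) //.
rewrite ifN; last by rewrite -leNgt le_max lexx.
rewrite ifN; last by rewrite -leNgt le_max lexx.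
rewrite maxxx sv_gt0 // (_ : between _ _ _) //.
by move: b1 b2; rewrite /between; lia.
Qed.

Variable f : 'I_d -> nat.
Hypotheses (f_inj : injective f) (mid : middle_oracle f).
Notation srt := (sorted (relpre f ltn)).

Lemma relpre_trans : transitive (relpre f ltn).
Proof. by move=> x y z; exact: ltn_trans. Qed.

(** The number of entries below [a] is the position at which [a] belongs. *)
Lemma nth_lt_count x0 s (a : nat) j : srt s -> (j < size s)%N ->
  (f (nth x0 s j) < a)%N = (j < count (fun i => f i < a)%N s)%N.
Proof.
elim: s j => // b s IH j; rewrite /= (path_sortedE relpre_trans) => /andP[bs ss].
case: (ltnP (f b) a) => ba.
  by case: j => [|j] js /=; [rewrite ba | rewrite IH].
have -> : count (fun i => f i < a)%N s = 0%N.
  apply/eqP; rewrite -leqn0 leqNgt -has_count; apply/hasPn => i /(allP bs) /= bi.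
  by rewrite -leqNgt (leq_trans ba) // ltnW.
case: j => [|j] js /=; first by rewrite ltnNge ba.
apply/negbTE; rewrite -leqNgt (leq_trans ba) // ltnW //.
by apply: (allP bs); exact: mem_nth.
Qed.

(** The bound [3 <= t] matters for the gap [0, 2]: its probes are 1 and 2, and 2 has
    to be a position in the list. *)
Lemma probesP jmin jmax t : (2 <= jmax - jmin)%N -> (jmax <= t.+1)%N -> (3 <= t)%N ->
  let: (j1, j2) := probes jmin jmax in
  [/\ 1 <= j1, jmin <= j1, j1 < j2, j2 <= t & (j2 - j1 < jmax - jmin) && (j1 < jmax)]%N.
Proof.
move=> D jt t3; rewrite /probes; by case: ifP => D3; [|case: ifP => j0]; split; lia.
Qed.

(** Loop invariant: the correct gap [g] satisfies [jmin <= g < jmax].  Each oracle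
    answer says on which side of the two probed entries [x] lies, so the invariant
    is kept, and every one of the three new intervals is shorter. *)
Lemma search_positionP s x ys fuel k jmin jmax (g := count (fun i => f i < f x)%N s) :
  srt s -> x \notin s -> (3 <= size s)%N ->
  (jmin <= g < jmax)%N -> (jmax <= (size s).+1)%N -> (jmax - jmin <= fuel.+1)%N ->
  search_position rho T fuel s x ys k jmin jmax = Some (g, g.+1).
Proof.
move=> ss xs s3; elim: fuel k jmin jmax => [|fuel IH] k jmin jmax /andP[ming gmax] maxs fl /=.
  by rewrite ltnS fl; congr (Some (_, _)); lia.
case: ltnP => D; first by congr (Some (_, _)); lia.
have := probesP D maxs s3; case: (probes jmin jmax) => j1 j2 [j1_1 minj1 j12 j2s /andP[j2j1 j1max]].
set a := nth x s j1.-1; set b := nth x s j2.-1.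
have j1s : (j1.-1 < size s)%N by lia.
have j2s' : (j2.-1 < size s)%N by lia.
have as_ : a \in s by exact: mem_nth.
have bs_ : b \in s by exact: mem_nth.
have xa : x != a by apply: contraNneq xs => ->.
have xb : x != b by apply: contraNneq xs => ->.
have fab : (f a < f b)%N by apply: (sorted_ltn_nth relpre_trans) => //; rewrite ?inE; lia.
have ab : a != b by apply: contraTneq fab => ->; rewrite ltnn.
have ax := nth_lt_count x (f x) ss j1s; have bx := nth_lt_count x (f x) ss j2s'.
rewrite -/a -/b -/g in ax bx.
have fxa : f x != f a by rewrite (inj_eq f_inj).
have fxb : f x != f b by rewrite (inj_eq f_inj).
rewrite mid //; case: (ltnP g j1) => gj1.
  have -> : between (f a) (f x) (f b) = false by rewrite /between; lia.
  have -> : between (f b) (f a) (f x) by rewrite /between; lia.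
  by rewrite !inE eqxx /=; apply: IH => //; lia.
case: (ltnP g j2) => gj2.
  have -> : between (f a) (f x) (f b) by rewrite /between; lia.
  (* The membership tests of the loop compare ordered triples, so [(a, x, b)] must
     be told apart from both triples having [a] in the middle. *)
  rewrite !inE !xpair_eqE !eqxx (eq_sym a x) (negPf xa) (negPf ab) /=.
  by apply: IH => //; lia.
have -> : between (f a) (f x) (f b) = false by rewrite /between; lia.
have -> : between (f b) (f a) (f x) = false by rewrite /between; lia.
rewrite !inE !xpair_eqE !eqxx (eq_sym a x) (eq_sym b x) (negPf xa) (negPf ab) (negPf xb) /=.
by apply: IH => //; lia.
Qed.

Lemma insert_siteP ys s x : srt s -> x \notin s -> (3 <= size s)%N ->
  exists s', [/\ insert_site rho T ys s x = Some s', srt s' & perm_eq s' (x :: s)].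
Proof.
move=> ss xs s3; rewrite /insert_site.
set g := count (fun i => f i < f x)%N s.
have gs : (g <= size s)%N by exact: count_size.
rewrite search_positionP // -/g; exists (take g s ++ x :: drop g s); split => //; last first.
  by rewrite -cat1s perm_catCA cat1s perm_cons cat_take_drop.
move: ss (ss); rewrite -{1}(cat_take_drop g s) => + ss.
rewrite !(sorted_pairwise relpre_trans) !pairwise_cat /= allrel_consr.
move=> /and3P[-> -> ->]; rewrite !andbT.
apply/andP; split; apply/allP => i /(nthP x)[j].
  rewrite size_takel // => jg; rewrite nth_take // => <- /=.
  by rewrite nth_lt_count // (leq_trans jg).
rewrite size_drop nth_drop => js <- /=.
have gjs : (g + j < size s)%N by rewrite -ltn_subRL.
have := nth_lt_count x (f x) ss gjs; rewrite -/g [RHS]ltnNge leq_addr /= => fx.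
rewrite ltn_neqAle leqNgt fx andbT (inj_eq f_inj).
by apply: contraNneq xs => ->; exact: mem_nth.
Qed.

Lemma foldl_insertP (ys : nat -> nat -> multi_index n) rest s :
  srt s -> (3 <= size s)%N -> uniq (s ++ rest) ->
  exists s', [/\ foldl (fun os (x : 'I_d) => obind (fun s => insert_site rho T (ys x) s x) os)
      (Some s) rest = Some s', srt s' & perm_eq s' (s ++ rest)].
Proof.
elim: rest s => [|x rest IH] s ss s3 us /=; first by exists s; rewrite cats0.
have xs : x \notin s.
  by move: us; rewrite cat_uniq /= => /and3P[_]; rewrite negb_or => /andP[].
have [s1 [-> ss1 p1]] := insert_siteP (ys x) ss xs s3.
have p2 : perm_eq (s1 ++ rest) (s ++ x :: rest).
  by rewrite -(cat1s x rest) perm_sym perm_catCA catA perm_cat2r perm_sym.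
have [||s' [-> ss' p3]] := IH s1 ss1.
- by rewrite (perm_size p1) /= ltnW.
- by rewrite (perm_uniq p2).
by exists s'; split => //; exact: perm_trans p2.
Qed.
End algo.

(** A list of all sites sorted by position under [t] is the list of values of [t]. *)
Lemma sorted_codom d (s : seq 'I_d) (t : 'S_d) :
  sorted (relpre (fun i => nat_of_ord (t^-1%g i)) ltn) s -> perm_eq s (enum 'I_d) ->
  [pick t' : 'S_d | codom t' == s] = Some t.
Proof.
move=> ss ps.
have -> : s = codom t.
  apply: (irr_sorted_eq _ _ ss).
  - by move=> x y z; exact: ltn_trans.
  - by move=> x; rewrite /= ltnn.
  - rewrite codomE sorted_map (eq_sorted (e' := relpre val ltn)) -?sorted_map ?val_enum_ord ?iota_ltn_sorted //.
    by move=> i j /=; rewrite !permK.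
  - move=> i; rewrite (perm_mem ps) mem_enum; apply/esym/codomP.
    by exists (t^-1%g i); rewrite permKV.
case: pickP => [t' /eqP tt'|/(_ t)]; last by rewrite eqxx.
congr Some; apply/permP => i; move: tt'; rewrite !codomE => /eq_in_map; apply.
by rewrite mem_enum.
Qed.

(** The first call fixes an orientation: its output is increasing for the positions
    under [tau] or for those under the reversal of [tau].  From then on the list
    stays sorted for that orientation, and once it contains all sites it lists
    the values of the corresponding element of the class. *)
Lemma train_recovery_oracle (R : realType) d (n : d.-tuple nat) rho
    (T : multi_index n -> R) (tau : 'S_d) ys : (3 <= d)%N ->
  middle_oracle rho T (fun i => nat_of_ord (tau^-1%g i)) ->
  exists2 tau', train_recovery rho T ys = Some tau' & tau' \in tt_class tau.
Proof.
move=> d3 mid.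
pose f (t : 'S_d) i := nat_of_ord (t^-1%g i).
have fI t : injective (f t) by move=> i j /val_inj /perm_inj.
pose tau2 := (perm (@rev_ord_inj d) * tau)%g.
have f2 i : f tau2 i = (d - (f tau i).+1)%N.
  rewrite /f /tau2 invMg permM.
  have -> j : ((perm (@rev_ord_inj d))^-1)%g j = rev_ord j; last by [].
  by apply: (canLR (permK _)); rewrite permE rev_ordK.
have fd i : (f tau i < d)%N by exact: ltn_ord.
have mid2 : middle_oracle rho T (f tau2).
  move=> y i1 i2 i3 i12 i13 i23; rewrite mid // -!/(f tau _).
  have bE i j k : between (f tau2 i) (f tau2 j) (f tau2 k) = between (f tau i) (f tau j) (f tau k).
    by rewrite !f2 /between; have := fd i; have := fd j; have := fd k; lia.
  by rewrite !bE.
rewrite /train_recovery; case enumE : (enum 'I_d) => [|i1 [|i2 [|i3 rest]]].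
- by have := d3; rewrite -[X in (_ < X)%N](size_enum_ord d) enumE.
- by have := d3; rewrite -[X in (_ < X)%N](size_enum_ord d) enumE.
- by have := d3; rewrite -[X in (_ < X)%N](size_enum_ord d) enumE.
have uE : uniq [:: i1, i2, i3 & rest] by rewrite -enumE enum_uniq.
have [i12 i13 i23] : [/\ i1 != i2, i1 != i3 & i2 != i3].
  by move: uE; rewrite /= !inE !negb_or => /andP[/and3P[-> -> _] /andP[/andP[-> _] _]].
have orient a b c : between (f tau a) (f tau b) (f tau c) ->
    exists2 t, t \in tt_class tau &
      sorted (relpre (f t) ltn) [:: a; b; c] /\ middle_oracle rho T (f t).
  case/orP=> /andP[h1 h2]; [exists tau | exists tau2].
  - by rewrite !inE eqxx.
  - by rewrite /= h1 h2.
  - by rewrite !inE eqxx orbT.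
  - rewrite /= !f2 andbT; split=> //.
    by have := fd a; have := fd b; have := fd c; lia.
have [a [b [c [-> [t t_tau [ss midt]] pabc]]]] : exists a b c,
   [/\ three_index rho T (ys 0%N 0%N) i1 i2 i3 = Some (a, b, c),
    exists2 t, t \in tt_class tau & sorted (relpre (f t) ltn) [:: a; b; c] /\
      middle_oracle rho T (f t) & perm_eq [:: a; b; c] [:: i1; i2; i3]].
  rewrite mid // -!/(f tau _); case: ifPn => [b1|b1].
    exists i2, i1, i3; split=> //; first exact: orient.
    by rewrite (perm_catCA [:: i2] [:: i1] [:: i3]).
  case: ifPn => [b2|b2].
    exists i1, i2, i3; split=> //; apply: orient.
    by move: b2; rewrite /between orbC.
  exists i2, i3, i1; split=> //; last by rewrite (perm_catC [:: i2; i3] [:: i1]).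
  apply: orient; move: b1 b2; rewrite /between.
  have := i12; have := i13; have := i23.
  by rewrite -!(inj_eq (fI tau)); lia.
have pE : perm_eq ([:: a; b; c] ++ rest) (enum 'I_d).
  by rewrite enumE -[[:: i1, i2, i3 & rest]]/([:: i1; i2; i3] ++ rest) perm_cat2r.
have [||s' [-> ss' ps']] := foldl_insertP (fI t) midt ys (rest := rest) ss.
- by [].
- by rewrite (perm_uniq pE) enum_uniq.
by exists t => //=; apply: sorted_codom ss' (perm_trans ps' pE).
Qed.

Theorem corollary4p9 (R : realType) (d : nat) (n r : d.-tuple nat)
    (tau : 'S_d) (rho : nat)
    (d_ge3 : (3 <= d)%N)
    (n_gt0 : forall i : 'I_d, (0 < tnth n i)%N)
    (r_gt0 : forall j : 'I_d, (0 < tnth r j)%N)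
    (r_first : forall j : 'I_d, nat_of_ord j = 0%N -> tnth r j = 1%N)
    (rho_gt0 : (0 < rho)%N)
    (n_ends : forall j : 'I_d, nat_of_ord j = 0%N \/ nat_of_ord j = d.-1 ->
      (rho <= tnth n (tau j))%N)
    (n_middle : forall j : 'I_d, (0 < j < d.-1)%N ->
      (rho ^ 2 <= tnth n (tau j))%N)
    (r_bounds : forall j : 'I_d, (0 < j)%N -> (rho <= tnth r j < rho ^ 2)%N) :
  exists N : set (tt_params R n r tau), tt_null N /\
    forall u : tt_params R n r tau, ~ N u ->
    forall ys : nat -> nat -> multi_index n,
    exists2 tau' : 'S_d,
      train_recovery rho (tt_tensor u) ys = Some tau' & tau' \in tt_class tau.
Proof.
exists (@degenerate R d n r tau rho); split; first exact: tt_null_degenerate.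
move=> u ndu ys; apply: train_recovery_oracle => //.
apply: middle_oracle_rank => // [i j /val_inj /perm_inj //|y i j k ij ik jk].
exact: generic_rank.
Qed.
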